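(* Let $K$ be a commutative unital ring and $G$ a group. Let $\beta=(G,X,\{X_g\},\{\beta_g\})$ be a right partial action of $G$ on a $K$-module $X$, let $\alpha=(G,Y,\{Y_g\},\{\alpha_g\})$ be a left partial action of $G$ on a $K$-module $Y$, and let $Z$ be a $K$-module. Suppose that $\phi:X\times Y\to Z$ is a $K$-bilinear map such that $\phi((x)\beta_g,y)=\phi(x,\alpha_g(y))$ for all $g\in G$, $x\in X_{g^{-1}}$, $y\in Y_{g^{-1}}$. Then there exists a unique $K$-linear map $\tilde\phi:X\otimes_{G_{par}}Y\to Z$ such that $\tilde\phi(x\otimes_{G_{par}}y)=\phi(x,y)$ for all $x\in X$, $y\in Y$.
   Context: $K$ is a fixed commutative unital ring; $G$ is a group. A left partial action $\alpha=(G,Y,\{Y_g\},\{\alpha_g\})$ of $G$ on a $K$-module $Y$ consists of $K$-submodules $Y_g\subseteq Y$ and $K$-linear isomorphisms $\alpha_g:Y_{g^{-1}}\to Y_g$ such that (i) $Y_1=Y$, $\alpha_1=\mathrm{id}_Y$; (ii) $\alpha_g(Y_{g^{-1}}\cap Y_{g^{-1}h})\subseteq Y_g\cap Y_h$; (iii) $\alpha_g\alpha_h(y)=\alpha_{gh}(y)$ for $y\in Y_{h^{-1}}\cap Y_{h^{-1}g^{-1}}$. A right partial action $\beta=(G,X,\{X_g\},\{\beta_g\})$ on a $K$-module $X$ is a left partial action of $G^{op}$: $K$-submodules $X_g$ and $K$-linear isomorphisms $\beta_g:X_{g^{-1}}\to X_g$, written $x\mapsto(x)\beta_g$, with $X_1=X$,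 $\beta_1=\mathrm{id}_X$, $(X_h\cap X_{g^{-1}})\beta_g\subseteq X_{hg}\cap X_g$, and $(x)\beta_g\beta_h=(x)\beta_{gh}$ for $x\in X_{h^{-1}g^{-1}}\cap X_{g^{-1}}$. The partial tensor product is $X\otimes_{G_{par}}Y:=(X\otimes_KY)/\mathcal K_{\beta,\alpha}$, where $\mathcal K_{\beta,\alpha}$ is the $K$-submodule generated by all $(x)\beta_g\otimes y-x\otimes\alpha_g(y)$ with $g\in G$, $x\in X_{g^{-1}}$, $y\in Y_{g^{-1}}$; $x\otimes_{G_{par}}y$ denotes the class of $x\otimes y$. *)

(* Defs.v *)
From HB Require Import structures.
From mathcomp Require Import all_boot all_algebra.
From mathcomp Require Import finmap.
From mathcomp Require Import boolp classical_sets functions.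
From mathcomp Require Import monalg.

Set Implicit Arguments.
Unset Strict Implicit.
Unset Printing Implicit Defensive.

Import GRing.Theory.
Local Open Scope classical_set_scope.
Local Open Scope quotient_scope.
Local Open Scope ring_scope.

(* The free K-module on T: the finitely supported functions T -> K. The library
   makes [malg] an lmodType over nonzero rings only, so the scalar action is
   redone here in order to allow K = 0. *)
Section FreeModule.
Variables (K : comPzRingType) (T : choiceType).

Definition freemod := malg T K.
HB.instance Definition _ := GRing.Zmodule.on freemod.

Definition freemod_gen (t : T) : freemod := mkmalgU t (1 : K).

Definition freemod_scale (a : K) (f : freemod) : freemod :=
  mkmalg [fsfun t in msupp f => a * mcoeff t f].

Lemma freemod_scaleE a f t :
  mcoeff t (freemod_scale a f) = a * mcoeff t f.
Proof.
by rewrite mcoeffE; case: msuppP => // _; rewrite mulr0.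
Qed.

Lemma freemod_scaleA a b f :
  freemod_scale a (freemod_scale b f) = freemod_scale (a * b) f.
Proof. by apply/malgP => t; rewrite !freemod_scaleE mulrA. Qed.

Lemma freemod_scale1 : left_id 1 freemod_scale.
Proof. by move=> f; apply/malgP => t; rewrite freemod_scaleE mul1r. Qed.

Lemma freemod_scaleDr : right_distributive freemod_scale +%R.
Proof.
move=> a f g; apply/malgP => t.
by rewrite !(freemod_scaleE, fgaddE) mulrDr.
Qed.

Lemma freemod_scaleDl f :
  {morph freemod_scale^~ f : a b / a + b}.
Proof.
move=> a b; apply/malgP => t.
by rewrite !(freemod_scaleE, fgaddE) mulrDl.
Qed.

HB.instance Definition _ := GRing.Zmodule_isLmodule.Build K freemod
  freemod_scaleA freemod_scale1 freemod_scaleDr freemod_scaleDl.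

End FreeModule.

Section QuotientModule.
Variables (K : pzRingType) (V : lmodType K) (S : set V).

Definition gen_submod : {pred V} := [pred v | `[<
  forall P : {pred V}, submod_closed P -> (forall u, S u -> u \in P) ->
  v \in P >]].

Lemma gen_submod_closed : submod_closed gen_submod.
Proof.
split; first by apply/asboolP => P [].
move=> a u v /asboolP uS /asboolP vS; apply/asboolP => P Pc SP.
by apply: Pc.2; [exact: uS | exact: vS].
Qed.

HB.instance Definition _ :=
  GRing.isSubmodClosed.Build K V gen_submod gen_submod_closed.

Definition quotmod := Quotient.quot gen_submod.
HB.instance Definition _ := GRing.Zmodule.on quotmod.
HB.instance Definition _ := Quotient.on quotmod.

Definition quotmod_scale (a : K) : quotmod -> quotmod :=
  lift_fun1 quotmod (fun v => \pi_quotmod (a *: v)).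

Lemma pi_scale a v :
  quotmod_scale a (\pi_quotmod v) = \pi_quotmod (a *: v).
Proof.
rewrite /quotmod_scale; unlock.
apply/eqP; rewrite -[_ == _]Quotient.idealrBE -scalerBr.
apply: rpredZ; rewrite Quotient.idealrBE; exact/eqP/reprK.
Qed.

Lemma quotmodP (P : quotmod -> Prop) :
  (forall v, P (\pi_quotmod v)) -> forall q, P q.
Proof. by move=> Ppi q; rewrite -[q]reprK. Qed.

Lemma quotmod_scaleA a b q :
  quotmod_scale a (quotmod_scale b q) = quotmod_scale (a * b) q.
Proof. by elim/quotmodP: q => v; rewrite !pi_scale scalerA. Qed.

Lemma quotmod_scale1 : left_id 1 quotmod_scale.
Proof. by elim/quotmodP => v; rewrite pi_scale scale1r. Qed.

Lemma quotmod_scaleDr : right_distributive quotmod_scale +%R.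
Proof.
move=> a; elim/quotmodP => u; elim/quotmodP => v.
by rewrite -raddfD !pi_scale scalerDr raddfD.
Qed.

Lemma quotmod_scaleDl q : {morph quotmod_scale^~ q : a b / a + b}.
Proof.
by elim/quotmodP: q => v a b; rewrite !pi_scale scalerDl raddfD.
Qed.

HB.instance Definition _ := GRing.Zmodule_isLmodule.Build K quotmod
  quotmod_scaleA quotmod_scale1 quotmod_scaleDr quotmod_scaleDl.

End QuotientModule.

Section TensorProduct.
Variables (K : comPzRingType) (X Y : lmodType K).

Local Notation pair x y := (freemod_gen K ((x, y) : (X * Y)%type)).

Inductive tensor_rel : set (freemod K (X * Y)%type) :=
| TensorAddl x x' y : tensor_rel (pair (x + x') y - pair x y - pair x' y)
| TensorAddr x y y' : tensor_rel (pair x (y + y') - pair x y - pair x y')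
| TensorScalel a x y : tensor_rel (pair (a *: x) y - a *: pair x y)
| TensorScaler a x y : tensor_rel (pair x (a *: y) - a *: pair x y).

Definition tensor := quotmod tensor_rel.
HB.instance Definition _ := GRing.Lmodule.on tensor.

Definition tens (x : X) (y : Y) : tensor := \pi_(quotmod tensor_rel) (pair x y).

End TensorProduct.

(* [ldom g] and [lact g] are Y_g and alpha_g; only the values of [lact g] on
   Y_{g^-1} are meaningful, as the fields constrain nothing outside of it. *)
Record left_partial_action (K : comPzRingType) (G : groupType)
    (Y : lmodType K) := LeftPartialAction {
  ldom : G -> submodClosed Y;
  lact : G -> Y -> Y;
  lact_linear : forall g a, {in ldom (g^-1)%g &,
    forall u v, lact g (a *: u + v) = a *: lact g u + lact g v};
  lact_bij : forall g,
    set_bij [set` ldom (g^-1)%g] [set` ldom g] (lact g);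
  ldom1 : forall y, y \in ldom 1%g;
  lact1 : forall y, lact 1%g y = y;
  lact_dom : forall g h y, y \in ldom (g^-1)%g -> y \in ldom (g^-1 * h)%g ->
    lact g y \in ldom g /\ lact g y \in ldom h;
  lact_comp : forall g h y,
    y \in ldom (h^-1)%g -> y \in ldom (h^-1 * g^-1)%g ->
    lact g (lact h y) = lact (g * h)%g y
}.

(* [ract g x] is (x)beta_g; same conventions as above. *)
Record right_partial_action (K : comPzRingType) (G : groupType)
    (X : lmodType K) := RightPartialAction {
  rdom : G -> submodClosed X;
  ract : G -> X -> X;
  ract_linear : forall g a, {in rdom (g^-1)%g &,
    forall u v, ract g (a *: u + v) = a *: ract g u + ract g v};
  ract_bij : forall g,
    set_bij [set` rdom (g^-1)%g] [set` rdom g] (ract g);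
  rdom1 : forall x, x \in rdom 1%g;
  ract1 : forall x, ract 1%g x = x;
  ract_dom : forall g h x, x \in rdom h -> x \in rdom (g^-1)%g ->
    ract g x \in rdom (h * g)%g /\ ract g x \in rdom g;
  ract_comp : forall g h x,
    x \in rdom (h^-1 * g^-1)%g -> x \in rdom (g^-1)%g ->
    ract h (ract g x) = ract (g * h)%g x
}.

Section PartialTensorProduct.
Variables (K : comPzRingType) (G : groupType) (X Y : lmodType K).
Variables (beta : right_partial_action G X) (alpha : left_partial_action G Y).

Inductive partial_tensor_rel : set (tensor X Y) :=
| PartialTensorRel g x y :
    x \in rdom beta (g^-1)%g -> y \in ldom alpha (g^-1)%g ->
    partial_tensor_rel (tens (ract beta g x) y - tens x (lact alpha g y)).

Definition partial_tensor := quotmod partial_tensor_rel.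
HB.instance Definition _ := GRing.Lmodule.on partial_tensor.

Definition partial_tens (x : X) (y : Y) : partial_tensor :=
  \pi_(quotmod partial_tensor_rel) (tens x y).

End PartialTensorProduct.

(* Main.v *)
Require Import Defs.
From HB Require Import structures.
From mathcomp Require Import all_boot all_algebra.
From mathcomp Require Import finmap.
From mathcomp Require boolp classical_sets.
From mathcomp Require Import monalg.

(** The partial tensor product is a quotient of a quotient of the free module on
    X * Y, so its universal property is the composite of three simpler ones. The
    free module extends any function on its basis ([freemod_lift]); a quotient
    by the submodule generated by S receives any linear map that vanishes on S
    ([quotmod_universal]). Bilinearity of phi says that its extension to the
    free module vanishes on the tensor relations, which gives the universal
    property of the tensor product ([tensor_universal]); balancedness says that
    the resulting map vanishes on the relations that identify the tensors of
    (beta_g x, y) and (x, alpha_g y), which gives the map on the partial tensor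
    product.

    Uniqueness uses that the quotient maps are surjective and that the basis
    spans the free module, so that a linear map is determined by its values on
    pure tensors ([tensor_hom_ext]). Pointwise equal linear maps are then equal
    as bundled structures ([linear_map_ext]). *)

Set Implicit Arguments.
Unset Strict Implicit.
Unset Printing Implicit Defensive.

Import GRing.Theory.
Local Open Scope ring_scope.

(** A bundled linear map is a function together with two proofs, so function
    extensionality and proof irrelevance reduce equality to the values. *)
Lemma linear_map_ext (K : pzRingType) (U V : lmodType K)
    (f g : {linear U -> V}) : f =1 g -> f = g.
Proof.
case: f g => [f [[f0] [fZ]]] [g [[g0] [gZ]]] /= /boolp.funext fg.
case: g / fg g0 gZ => g0 gZ.
by rewrite (boolp.Prop_irrelevance g0 f0) (boolp.Prop_irrelevance gZ fZ).
Qed.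

Section FreeModuleUniversal.
Variables (K : comPzRingType) (T : choiceType) (Z : lmodType K).
Implicit Types (f : T -> Z) (u v : freemod K T).

Definition freemod_lift f u : Z := \sum_(t <- msupp u) mcoeff t u *: f t.

(** The support of a sum may shrink, so two lifts are comparable only after both
    sums are taken over one common finite set. *)
Lemma freemod_liftEw f u (d : {fset T}) : (msupp u `<=` d)%fset ->
  freemod_lift f u = \sum_(t <- d) mcoeff t u *: f t.
Proof.
move=> le_ud; apply: (big_fset_incl _ le_ud) => t _ /mcoeff_outdom ->.
exact: scale0r.
Qed.

Lemma freemod_lift_linear f : linear (freemod_lift f).
Proof.
move=> a u v.
pose d := (msupp (a *: u + v) `|` (msupp u `|` msupp v))%fset.
rewrite !(@freemod_liftEw _ _ d); first last.
- exact: fsubsetUl.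
- by apply: fsubset_trans (fsubsetUr _ _); exact: fsubsetUl.
- by apply: fsubset_trans (fsubsetUr _ _); exact: fsubsetUr.
rewrite scaler_sumr -big_split; apply: eq_bigr => t _ /=.
by rewrite mcoeffD freemod_scaleE scalerDl scalerA.
Qed.

HB.instance Definition _ f :=
  GRing.isLinear.Build K (freemod K T) Z *:%R (freemod_lift f)
    (freemod_lift_linear f).

(** Over the zero ring the generator is 0 and its support is empty; summing over
    the singleton of t covers this case too. *)
Lemma freemod_lift_gen f t : freemod_lift f (freemod_gen K t) = f t.
Proof.
by rewrite (freemod_liftEw f msuppU_le) big_seq_fset1 mcoeffUU scale1r.
Qed.

Lemma freemod_genE u :
  u = \sum_(t <- msupp u) mcoeff t u *: freemod_gen K t.
Proof.
rewrite [LHS]monalgE; apply: eq_bigr => t _; apply/malgP => s.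
by rewrite freemod_scaleE !mcoeffU mulrnAr mulr1.
Qed.

Lemma freemod_hom_ext (f g : {linear freemod K T -> Z}) :
  (forall t, f (freemod_gen K t) = g (freemod_gen K t)) -> f =1 g.
Proof.
move=> fg u; rewrite [u]freemod_genE !linear_sum; apply: eq_bigr => t _.
by rewrite !linearZ fg.
Qed.

End FreeModuleUniversal.

Section QuotientModuleUniversal.
Variables (K : pzRingType) (V : lmodType K) (S : classical_sets.set V).
Local Open Scope quotient_scope.
Local Notation proj := (\pi_(quotmod S)).

Lemma quotmod_pi_linear : linear proj.
Proof.
by move=> a u v; rewrite raddfD; congr (_ + _); rewrite -[LHS]pi_scale.
Qed.

HB.instance Definition _ :=
  GRing.isLinear.Build K V (quotmod S) *:%R proj quotmod_pi_linear.

Variable Z : lmodType K.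

(** The kernel of f is one of the submodules containing S over which
    [gen_submod] takes the intersection. *)
Lemma gen_submod_ker (f : {linear V -> Z}) :
  (forall s, S s -> f s = 0) -> {in gen_submod S, forall v, f v = 0}.
Proof.
move=> fS v /boolp.asboolP/(_ [pred u | f u == 0]) fv; apply/eqP/fv.
- split=> [|a u w]; rewrite !inE ?linear0 ?linearP // => /eqP-> /eqP->.
  by rewrite scaler0 addr0.
- by move=> u /fS fu0; rewrite inE fu0.
Qed.

(** Evaluating at the canonical representative defines the map before any
    compatibility is known; for a linear f that vanishes on S the choice of
    representative does not matter. *)
Definition quotmod_lift (f : V -> Z) (q : quotmod S) : Z := f (repr q).

Lemma quotmod_lift_pi (f : {linear V -> Z}) v :
  (forall s, S s -> f s = 0) -> quotmod_lift f (proj v) = f v.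
Proof.
move=> fS; apply/eqP; rewrite -subr_eq0 -linearB; apply/eqP.
apply: (gen_submod_ker fS); rewrite Quotient.idealrBE; exact/eqP/reprK.
Qed.

Lemma quotmod_lift_linear (f : {linear V -> Z}) :
  (forall s, S s -> f s = 0) -> linear (quotmod_lift f).
Proof.
move=> fS a; elim/quotmodP => u; elim/quotmodP => v.
by rewrite -linearP !quotmod_lift_pi // linearP.
Qed.

Lemma quotmod_universal (f : {linear V -> Z}) :
  (forall s, S s -> f s = 0) ->
  exists fq : {linear quotmod S -> Z}, forall v, fq (proj v) = f v.
Proof.
move=> fS.
pose L := GRing.isLinear.Build K (quotmod S) Z *:%R (quotmod_lift f)
  (quotmod_lift_linear fS).
pose fq : {linear _ -> _} := HB.pack (quotmod_lift f) L.
by exists fq => v; exact: quotmod_lift_pi.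
Qed.

End QuotientModuleUniversal.

Section TensorUniversal.
Variables (K : comPzRingType) (X Y Z : lmodType K).

Lemma tensor_universal (phi : X -> Y -> Z) :
    (forall y, linear (phi^~ y)) -> (forall x, linear (phi x)) ->
  exists f : {linear tensor X Y -> Z}, forall x y, f (tens x y) = phi x y.
Proof.
move=> lin_l lin_r.
pose psi : {linear freemod K (X * Y)%type -> Z} :=
  freemod_lift (fun p : X * Y => phi p.1 p.2).
have psiE x y : psi (freemod_gen K (x, y)) = phi x y by apply: freemod_lift_gen.
have [|f fE] := @quotmod_universal _ _ (@tensor_rel K X Y) _ psi.
  pose isL y := GRing.isLinear.Build K X Z *:%R (phi^~ y) (lin_l y).
  pose isR x := GRing.isLinear.Build K Y Z *:%R (phi x) (lin_r x).
  pose L y : {linear X -> Z} := HB.pack (phi^~ y) (isL y).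
  pose R x : {linear Y -> Z} := HB.pack (phi x) (isR x).
  have phiDl x x' y : phi (x + x') y = phi x y + phi x' y := linearD (L y) x x'.
  have phiDr x y y' : phi x (y + y') = phi x y + phi x y' := linearD (R x) y y'.
  have phiZl a x y : phi (a *: x) y = a *: phi x y := linearZ_LR (L y) a x.
  have phiZr a x y : phi x (a *: y) = a *: phi x y := linearZ_LR (R x) a y.
  move=> _ [x x' y|x y y'|a x y|a x y].
  - by rewrite !linearB !psiE phiDl addrAC addrK subrr.
  - by rewrite !linearB !psiE phiDr addrAC addrK subrr.
  - by rewrite linearB linearZ_LR !psiE phiZl subrr.
  - by rewrite linearB linearZ_LR !psiE phiZr subrr.
by exists f => x y; rewrite fE psiE.
Qed.

Lemma tensor_hom_ext (f g : {linear tensor X Y -> Z}) :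
  (forall x y, f (tens x y) = g (tens x y)) -> f =1 g.
Proof.
move=> fg; elim/quotmodP.
apply: (freemod_hom_ext (f := f \o \pi_(quotmod _)%qT)
                        (g := g \o \pi_(quotmod _)%qT)).
by case=> x y; exact: fg.
Qed.

End TensorUniversal.

Theorem proposition2p15 (K : comPzRingType) (G : groupType)
    (X Y Z : lmodType K)
    (beta : right_partial_action G X) (alpha : left_partial_action G Y)
    (phi : X -> Y -> Z)
    (phi_linl : forall y, linear (phi^~ y))
    (phi_linr : forall x, linear (phi x))
    (phi_balanced : forall (g : G) (x : X) (y : Y),
      x \in rdom beta (g^-1)%g -> y \in ldom alpha (g^-1)%g ->
      phi (ract beta g x) y = phi x (lact alpha g y)) :
  exists! phit : {linear partial_tensor beta alpha -> Z},
    forall (x : X) (y : Y), phit (partial_tens beta alpha x y) = phi x y.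
Proof.
have [f fE] := tensor_universal phi_linl phi_linr.
have [|fq fqE] := @quotmod_universal _ _ (partial_tensor_rel beta alpha) _ f.
  move=> _ [g x y xg yg].
  by rewrite linearB /= !fE phi_balanced // subrr.
exists fq; split=> [x y|h hE]; first by rewrite -fE -fqE.
apply: linear_map_ext; elim/quotmodP.
apply: (tensor_hom_ext (f := fq \o \pi_(quotmod _)%qT)
                       (g := h \o \pi_(quotmod _)%qT)).
by move=> x y /=; rewrite fqE fE -hE.
Qed.
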